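(* Let $X,Y$ be real topological-linear spaces, $\Omega\subseteq X$ nonempty, $f:X\to Y$, and $\psi:Y\to\mathbb R$ a seminorm. Assume that $K\subseteq Y$ is a nontrivial, solid cone, $\mathbb A(\cdot):=\mathbb R_+\cdot(f[\Omega]-f(\cdot))$ or $\mathbb A(\cdot):=\mathbb R_+\cdot(f[\Omega]+K-f(\cdot))$ on $\Omega$, $\bar x\in\Omega$, and $A:=\mathbb A(\bar x)$ is nontrivial. Moreover, suppose that $B_K(\psi)$ and $B_A(\psi)$ are normlike-bases for $K$ and $A$, respectively. Suppose that $S_{-K}(\psi)$ is solid and $S^0_A(\psi)\cap\operatorname{int}S_{-K}(\psi)=\emptyset$. Then there is $(x^*,\alpha)\in K^{a\circ}(\psi)$ such that, with $C:=C_\psi(x^*,\alpha)$, $\bar x\in\mathrm{WEff}(\Omega\mid f,C)$. Moreover, if $\operatorname{int}C\ne\emptyset$ and $\varphi:Y\to\mathbb R$ is a sublinear functional with $\varphi(0)=0$ which is $-C$ representing, then: (i) for any $k\in\operatorname{int}C$, $(\bar x,0)$ is a solution of $(P_\varphi^{a,k})$ for $a=f(\bar x)$; (ii) if $\varphi$ is strictly $-C$ representing (e.g. if $\varphi=\varphi_{x^*,\alpha}$ and $C^>_\psi(x^*,\alpha)\neq\emptyset$), then $\bar x\in\operatorname{argmin}_{x\in\Omega}\varphi(f(x)-f(\bar x))$; (iii) if $\mathcal P\subseteq Y$, $\mathcal T\subseteq\operatorname{int}C$, $\mathcal R\subseteq\mathbb R$ satisfy $f[\mathrm{WEff}(\Omega\mid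 f,C)]\subseteq\mathcal P+\mathcal R\cdot\mathcal T$, then there are $a\in\mathcal P$, $k\in\mathcal T$, $s\in\mathcal R$ so that $(\bar x,s)$ is a solution of $(P_\varphi^{a,k})$; (iv) if, in addition to the assumption in (iii), $C$ is closed and nontrivial, then there are $a\in\mathcal P$, $k\in\mathcal T$, $s\in\mathcal R$ so that $s=\varphi^G_{a-C,k}(f(\bar x))=\min_{x\in\Omega}\varphi^G_{a-C,k}(f(x))$.
   Context: $Y^*$ is the topological dual of $Y$, $\mathbb R_+=[0,\infty)$. A set $K\subseteq Y$ is a cone if $0\in K=\mathbb R_+\cdot K$ (not necessarily convex); it is nontrivial if $\{0\}\ne K\ne Y$. A set is solid if its topological interior is nonempty. For a cone $M$: $B_M(\psi):=\{x\in M\mid\psi(x)=1\}$, $S_M(\psi):=\operatorname{conv}(B_M(\psi))$, $S^0_M(\psi):=\operatorname{conv}(\{0\}\cup B_M(\psi))$; $B_M(\psi)$ is a normlike-base for the nontrivial cone $M$ if $\psi>0$ on $M\setminus\{0\}$. $K^{a\circ}(\psi):=\{(x^*,\alpha)\in Y^*\times\mathbb R_+\mid\forall y\in\operatorname{int}K:\ x^*(y)-\alpha\psi(y)>0\}$. $C_\psi(x^*,\alpha):=\{y\in Y\mid x^*(y)\ge\alpha\psi(y)\}$, $C^>_\psi(x^*,\alpha):=\{y\in Y\mid x^*(y)>\alpha\psi(y)\}$, $\varphi_{x^*,\alpha}(y):=x^*(y)+\alpha\psi(y)$. $\varphi$ is $-C$ representing if $-C=\{y\in Y\mid\varphi(y)\le0\}$,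 and strictly $-C$ representing if in addition $-\operatorname{int}C=\{y\in Y\mid\varphi(y)<0\}$. $\mathrm{WEff}(\Omega\mid f,C)$ is the set of $\bar x\in\Omega$ for which there is no $x\in\Omega$ with $f(x)\in f(\bar x)-\operatorname{int}C$. $f[D]$ is the image of $D$. $(P_\varphi^{a,k})$ is the problem: minimize $\lambda$ subject to $\varphi(f(x)-a-\lambda k)\le0$, $(x,\lambda)\in\Omega\times\mathbb R$; a solution is a feasible pair with $\lambda$ minimal among all feasible pairs. $\varphi^G_{a-C,k}(y):=\inf\{t\in\mathbb R\mid y\in tk+(a-C)\}\in\mathbb R\cup\{\pm\infty\}$ ($\inf\emptyset=+\infty$). *)

(* Defs.v *)
From HB Require Import structures.
From mathcomp Require Import all_boot all_order all_algebra.
From mathcomp Require Import all_classical all_reals all_analysis.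

Set Implicit Arguments.
Unset Strict Implicit.
Unset Printing Implicit Defensive.

Import Order.TTheory GRing.Theory Num.Theory.
Import numFieldNormedType.Exports.

Local Open Scope classical_set_scope.
Local Open Scope ring_scope.

Definition set_opp (R : realType) (Y : lmodType R) (S : set Y) : set Y :=
  [set - y | y in S].

Definition set_add (R : realType) (Y : lmodType R) (S T : set Y) : set Y :=
  [set y + z | y in S & z in T].

Definition set_scale (R : realType) (Y : lmodType R) (L : set R) (S : set Y) :
    set Y :=
  [set t *: y | t in L & y in S].

Definition nonneg_reals (R : realType) : set R := [set t | 0 <= t].
Arguments nonneg_reals R : clear implicits.

(* Cones need not be convex. *)
Definition is_cone (R : realType) (Y : lmodType R) (K : set Y) : Prop :=
  K 0 /\ K = set_scale (nonneg_reals R) K.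

Definition nontrivial_set (R : realType) (Y : lmodType R) (K : set Y) : Prop :=
  K <> [set 0] /\ K <> setT.

Definition solid (R : realType) (Y : topologicalLmodType R) (S : set Y) : Prop :=
  interior S !=set0.

(* No continuity is required. Nonnegativity follows from the two axioms. *)
Definition is_seminorm (R : realType) (Y : lmodType R) (psi : Y -> R) : Prop :=
  (forall x y, psi (x + y) <= psi x + psi y) /\
  (forall (t : R) y, psi (t *: y) = `|t| * psi y).

Definition is_sublinear (R : realType) (Y : lmodType R) (phi : Y -> R) : Prop :=
  (forall x y, phi (x + y) <= phi x + phi y) /\
  (forall (t : R) y, 0 <= t -> phi (t *: y) = t * phi y).

(* The library states convexity on [convex_lmodType Y], an alias of Y carrying
   the convex-combination operation. *)
Definition conv_hull (R : realType) (Y : lmodType R) (S : set Y) : set Y :=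
  @smallest (convex_lmodType Y) (@convex_set R Y) S.

Definition psi_base (R : realType) (Y : lmodType R) (psi : Y -> R) (M : set Y) :
    set Y :=
  [set y | M y /\ psi y = 1].

Definition psi_conv (R : realType) (Y : lmodType R) (psi : Y -> R) (M : set Y) :
    set Y :=
  conv_hull (psi_base psi M).

Definition psi_conv0 (R : realType) (Y : lmodType R) (psi : Y -> R)
    (M : set Y) : set Y :=
  conv_hull ([set 0] `|` psi_base psi M).

(* [psi_base psi M] is a normlike-base for M; meant for nontrivial cones M. *)
Definition normlike_base (R : realType) (Y : lmodType R) (psi : Y -> R)
    (M : set Y) : Prop :=
  forall y, M y -> y <> 0 -> 0 < psi y.

(* The set of pairs in (topological dual of Y) x R_+ that are strictly positive
   on int K. Continuity of the linear part puts it in the topological dual. *)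
Definition aug_dual_int (R : realType) (Y : topologicalLmodType R)
    (psi : Y -> R) (K : set Y) : set ({linear Y -> R^o} * R) :=
  [set p : {linear Y -> R^o} * R |
             [/\ continuous (p.1 : Y -> R^o),
               0 <= p.2 &
               forall y, interior K y -> 0 < (p.1 y : R) - p.2 * psi y]].

Definition BP_cone (R : realType) (Y : lmodType R) (psi : Y -> R)
    (xs : Y -> R) (alpha : R) : set Y :=
  [set y | alpha * psi y <= xs y].

Definition BP_cone_gt (R : realType) (Y : lmodType R) (psi : Y -> R)
    (xs : Y -> R) (alpha : R) : set Y :=
  [set y | alpha * psi y < xs y].

Definition BP_fun (R : realType) (Y : lmodType R) (psi : Y -> R)
    (xs : Y -> R) (alpha : R) : Y -> R :=
  fun y => xs y + alpha * psi y.

Definition representing (R : realType) (Y : lmodType R) (C : set Y)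
    (phi : Y -> R) : Prop :=
  set_opp C = [set y | phi y <= 0].

Definition strictly_representing (R : realType) (Y : topologicalLmodType R)
    (C : set Y) (phi : Y -> R) : Prop :=
  representing C phi /\ set_opp (interior C) = [set y | phi y < 0].

Definition WEff (R : realType) (X : Type) (Y : topologicalLmodType R)
    (Omega : set X) (f : X -> Y) (C : set Y) : set X :=
  [set xb | Omega xb /\
     ~ (exists2 x, Omega x & exists2 c, interior C c & f x = f xb - c)].

Definition argmin_set (X : Type) (d : Order.disp_t) (V : porderType d)
    (Omega : set X) (g : X -> V) : set X :=
  [set xb | Omega xb /\ forall x, Omega x -> (g xb <= g x)%O].

Definition PS_feasible (R : realType) (X : Type) (Y : lmodType R)
    (Omega : set X) (f : X -> Y) (phi : Y -> R) (a k : Y) : set (X * R) :=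
  [set p | Omega p.1 /\ phi (f p.1 - a - p.2 *: k) <= 0].

Definition PS_solution (R : realType) (X : Type) (Y : lmodType R)
    (Omega : set X) (f : X -> Y) (phi : Y -> R) (a k : Y) : set (X * R) :=
  argmin_set (PS_feasible Omega f phi a k) snd.

(* Gerstewitz functional y |-> inf {t | y in t k + D}; ereal_inf set0 = +oo. *)
Definition gerstewitz (R : realType) (Y : lmodType R) (D : set Y) (k : Y)
    (y : Y) : \bar R :=
  ereal_inf [set t%:E | t in [set t : R | set_add [set t *: k] D y]].

(* Main.v *)
(* Hahn-Banach separates the convex sets int S_{-K} and S^0_A by some x^*; put
   alpha = - sup x^* over int S_{-K}, which is nonnegative since 0 lies in S^0_A.
   By homogeneity x^* >= alpha psi on K and x^* + alpha psi >= 0 on A. Since x^*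
   is not constant on S_{-K}, the superlinear functional x^* - alpha psi takes a
   positive value somewhere, and then it is positive on all of int C; this gives
   strictness on int K and shows that A misses - int C, i.e. the weak efficiency
   of xbar. The scalarization results follow from C + int C being inside int C.
   Separation in a topological vector space that need not be locally convex is
   obtained by extending the cone generated by S^0_A - int S_{-K}, of which
   every difference v - u is an order unit, to a maximal cone. *)
Require Import Defs.
From HB Require Import structures.
From mathcomp Require Import all_boot all_order all_algebra.
From mathcomp Require Import all_classical all_reals all_analysis.
From mathcomp Require Import ring lra.

Set Implicit Arguments.
Unset Strict Implicit.
Unset Printing Implicit Defensive.

Import Order.TTheory GRing.Theory Num.Theory.
Import numFieldNormedType.Exports.

Local Open Scope classical_set_scope.
Local Open Scope ring_scope.

(** * Affine maps and rays in a topological vector space *)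

Lemma continuous_affine (R : realType) (Y : topologicalLmodType R) (a : R)
  (c : Y) : continuous (fun y : Y => a *: y + c).
Proof.
move=> y; refine (@continuous2_cvg Y Y Y Y (nbhs y) _ (fun y => a *: y)
  (fun=> c) (fun u v => u + v) (a *: y) c _ _ (@cvg_cst _ _ _ _ _)).
  exact: (@add_continuous Y (a *: y, c)).
refine (@continuous2_cvg Y R^o Y Y (nbhs y) _ (fun=> a) (fun y => y)
  (fun u v => u *: v) a y _ (@cvg_cst _ _ _ _ _) (@cvg_id _ _)).
exact: (@scale_continuous R Y (a, y)).
Qed.

Lemma continuous_ray (R : realType) (Y : topologicalLmodType R) (c y : Y) :
  continuous (fun t : R^o => c + t *: y).
Proof.
move=> t; refine (@continuous2_cvg R^o Y Y Y (nbhs t) _ (fun=> c)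
  (fun t => t *: y) (fun u v => u + v) c (t *: y) _ (@cvg_cst _ _ _ _ _) _).
  exact: (@add_continuous Y (c, t *: y)).
refine (@continuous2_cvg R^o R^o Y Y (nbhs t) _ (fun t => t) (fun=> y)
  (fun u v => u *: v) t y _ (@cvg_id _ _) (@cvg_cst _ _ _ _ _)).
exact: (@scale_continuous R Y (t, y)).
Qed.

Lemma nbhs_affine (R : realType) (Y : topologicalLmodType R) (a : R)
  (c y : Y) (W : set Y) :
  nbhs (a *: y + c) W -> nbhs y [set z | W (a *: z + c)].
Proof. by move=> nW; exact: (@continuous_affine R Y a c y). Qed.

(** Neighbourhoods are absorbing: this is what turns topological interiors into the order units and
    strict inequalities needed below. *)
Lemma nbhs_ray (R : realType) (Y : topologicalLmodType R) (c y : Y)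
  (W : set Y) : nbhs c W -> exists2 e : R, 0 < e & W (c + e *: y).
Proof.
move=> nW.
have : nbhs (0 : R^o) [set t : R^o | W (c + t *: y)].
  by apply: (@continuous_ray R Y c y 0); rewrite scale0r addr0.
move=> /nbhs_ballP[e /= e0 eW].
exists (e / 2); first by rewrite divr_gt0.
by apply: eW; rewrite /ball/= sub0r normrN gtr0_norm ?divr_gt0 //; lra.
Qed.

(** * Positive functionals from an order unit *)

(* Maximal cones avoiding [- d] are total, so that [y |-> sup {t | y - t d in M}]
   is odd as well as superadditive. *)
Lemma order_unit_functional (R : realType) (Y : lmodType R) (D : set Y)
  (d : Y) (DD : forall x y, D x -> D y -> D (x + y))
  (DZ : forall (t : R) x, 0 <= t -> D x -> D (t *: x)) (Dd : D d)
  (dunit : forall y, exists2 e : R, 0 < e & D (d + e *: y))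
  (dN : ~ D (- d)) :
  exists2 g : {linear Y -> R^o}, (forall x, D x -> 0 <= (g x : R)) & g d = 1.
Proof.
pose good (A : set Y) := [/\ D `<=` A, forall x y, A x -> A y -> A (x + y),
  forall (t : R) x, 0 <= t -> A x -> A (t *: x) & ~ A (- d)].
have goodD : good D by split.
have [|M [Mgood Mmax]] := @Zorn_bigcup Y [set A | A = set0 \/ good A].
  move=> F FS Ftot.
  have [[B [FB B0]]|F0] := pselect (exists B, F B /\ B !=set0); last first.
    left; apply/seteqP; split => // x [B FB Bx].
    by case: F0; exists B; split => //; exists x.
  have gd (A : set Y) x : F A -> A x -> good A.
    by move=> FA Ax; case: (FS _ FA) => [A0|//]; move: Ax; rewrite A0.
  right; split.
  - move=> x Dx; exists B => //.
    by case: B0 => b Bb; have [DB _ _ _] := gd _ _ FB Bb; exact: DB.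
  - move=> x y [A FA Ax] [A' FA' A'y].
    have [AA'|A'A] := Ftot _ _ FA FA'.
      exists A' => //; have [_ AD _ _] := gd _ _ FA' A'y.
      by apply: AD => //; exact: AA'.
    exists A => //; have [_ AD _ _] := gd _ _ FA Ax.
    by apply: AD => //; exact: A'A.
  - move=> t x t0 [A FA Ax]; exists A => //.
    by have [_ _ AZ _] := gd _ _ FA Ax; exact: AZ.
  - by move=> [A FA Ad]; have [_ _ _] := gd _ _ FA Ad; apply.
have {Mgood}[DM MD MZ MN] : good M.
  case: Mgood => // M0; exfalso; apply: (Mmax D); last by right.
  rewrite M0; split => //; by move=> /(_ d Dd).
have Md := DM _ Dd.
have M0 : M 0 by rewrite -(scale0r d); exact: MZ.
have Mtot y : M y \/ M (- y).
  have [|nMy] := pselect (M y); first by left.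
  (* [N] adjoins the ray of [y] to [M]. By maximality it cannot be good, so it contains
     [- d = m + t y]; solving for [- y] puts it in [M]. *)
  right; pose N := [set z | exists t m, [/\ 0 <= t, M m & z = m + t *: y]].
  have MN' : M `<` N.
    split; last first.
      by apply/existsNP; exists y; apply/not_implyP; split => //; exists 1, 0;
         split => //; rewrite add0r scale1r.
    by move=> z Mz; exists 0, z; split => //; rewrite scale0r addr0.
  have : N (- d).
    apply: contrapT => Nd; apply: (Mmax _ MN'); right; split => //.
    - by apply: subset_trans DM _; case: MN'.
    - move=> z z' [t [m [t0 Mm ->]]] [t' [m' [t'0 Mm' ->]]].
      exists (t + t'), (m + m'); split; [exact: addr_ge0|exact: MD|].
      by rewrite scalerDl addrACA.
    - move=> s z s0 [t [m [t0 Mm ->]]].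
      exists (s * t), (s *: m); split; [exact: mulr_ge0|exact: MZ|].
      by rewrite scalerDr scalerA.
  move=> [t [m [t0 Mm E]]].
  have t_gt0 : 0 < t.
    rewrite lt_neqAle t0 andbT; apply/eqP => t00; apply: MN.
    by rewrite E -t00 scale0r addr0.
  have -> : - y = t^-1 *: (m + d).
    have -> : m + d = - (t *: y) by rewrite -(opprK d) E opprD addrA subrr add0r.
    by rewrite scalerN scalerA mulVf ?scale1r ?gt_eqF.
  by apply: MZ; rewrite ?invr_ge0//; exact: MD.
pose E y := [set t : R | M (y - t *: d)].
(* The two members of [M] add up to [(s - t) d], for [s < t] a positive multiple of the excluded
   [- d]. *)
have Ele y s t : E y t -> M (s *: d - y) -> t <= s.
  move=> Et Ms; rewrite leNgt; apply/negP => st; apply: MN.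
  have -> : - d = (t - s)^-1 *: ((y - t *: d) + (s *: d - y)).
    rewrite [s *: d - y]addrC addrACA subrr add0r -scaleNr -scalerDl scalerA.
    have -> : (t - s)^-1 * (- t + s) = -1 by field; rewrite subr_eq0 gt_eqF.
    by rewrite scaleN1r.
  by apply: MZ; [rewrite invr_ge0 subr_ge0 ltW|exact: MD].
(* The order unit makes [E y] nonempty; the same fact for [- y] bounds [E y] from above. *)
have Elow y : exists s, E y s.
  have [e e0 De] := dunit y; exists (- e^-1); rewrite /E/=.
  have -> : y - (- e^-1) *: d = e^-1 *: (d + e *: y).
    by rewrite scaleNr opprK scalerDr scalerA mulVf ?gt_eqF// scale1r addrC.
  by apply: MZ; [rewrite invr_ge0 ltW|exact: DM].
have Esup y : has_sup (E y).
  split; first exact: Elow.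
  have [s Es] := Elow (- y); exists (- s) => t Et; apply: (Ele y) => //.
  by move: Es; rewrite /E/= scaleNr addrC.
pose g y := sup (E y).
have gE y t : E y t -> t <= g y by move=> Et; apply: ub_le_sup => //; have [] := Esup y.
have gM y : M y -> 0 <= g y by move=> My; apply: (gE _ _); rewrite /E/= scale0r subr0.
have gle y b : (forall t, E y t -> t <= b) -> g y <= b.
  move=> h; apply: ge_sup => //; exact: Elow.
have gDle y z : g y + g z <= g (y + z).
  rewrite -lerBrDr; apply: (gle _ _) => t Et; rewrite lerBrDr addrC -lerBrDr.
  apply: (gle _ _) => s Es; rewrite lerBrDr; apply: (gE _ _); rewrite /E/=.
  have -> : y + z - (s + t) *: d = (y - t *: d) + (z - s *: d).
    by rewrite scalerDl opprD (addrC (- (s *: d))) addrACA.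
  exact: MD.
have gN y : g (- y) = - g y.
  apply/le_anti/andP; split.
    rewrite -subr_le0 opprK; apply: le_trans (gDle _ _) _; rewrite addNr.
    by apply: (gle _ _) => t Et; apply: (Ele 0) => //; rewrite scale0r subr0.
  rewrite lerNl; apply/ler_addgt0Pr => e e0.
  (* Beyond the supremum the vector is outside [M], so totality puts its opposite in [M], which is
     membership in [E (- y)]. *)
  have [/gE|h] := Mtot (y - (g y + e) *: d); first by lra.
  have /gE : E (- y) (- (g y + e)).
    by move: h; rewrite /E/= scaleNr opprK opprB addrC.
  lra.
have gD y z : g (y + z) = g y + g z.
  apply/le_anti; rewrite gDle andbT.
  have := gDle (y + z) (- z); rewrite addrK gN; lra.
have gZ (t : R) y : g (t *: y) = t * g y.
  have gZpos (s : R) z : 0 < s -> g (s *: z) <= s * g z.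
    move=> s0; apply: (gle _ _) => r Er; rewrite -ler_pdivrMl//; apply: gE.
    have -> : E z (s^-1 * r) = M (s^-1 *: (s *: z - r *: d)).
      by rewrite /E/= scalerBr !scalerA mulVf ?gt_eqF// scale1r.
    by apply: MZ => //; rewrite invr_ge0 ltW.
  have gZge (s : R) z : 0 < s -> g (s *: z) = s * g z.
    move=> s0; apply/le_anti; rewrite gZpos//=.
    have := @gZpos s^-1 (s *: z); rewrite invr_gt0 => /(_ s0).
    by rewrite scalerA mulVf ?gt_eqF// scale1r ler_pdivlMl.
  have g0 : g 0 = 0 by have := gD 0 0; rewrite addr0; lra.
  have [t0|t0|->] := ltgtP t 0.
  - have := @gZge (- t) (- y); rewrite oppr_gt0 => /(_ t0).
    by rewrite scalerN scaleNr opprK gN mulrNN.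
  - exact: gZge.
  - by rewrite scale0r mul0r.
have gL : linear (g : Y -> R^o).
  by move=> t y z; rewrite gD gZ.
pose G : Y -> R^o := g.
pose gm := GRing.isLinear.Build R Y R^o *:%R G gL.
pose gl : {linear Y -> R^o} := HB.pack G gm.
exists gl; first by move=> x /DM; exact: gM.
apply/le_anti/andP; split.
  apply: (gle _ _) => t Et; apply: (Ele d) => //.
  by rewrite scale1r subrr.
by apply: (gE _ _); rewrite /E/= scale1r subrr.
Qed.

(** * Convex sets, separation and continuity of linear functionals *)

Lemma convex_setE (R : realType) (Y : lmodType R) (V : set Y) :
  @convex_set R Y V <-> (forall x y (t : R), 0 <= t -> t <= 1 -> V x -> V y ->
    V (t *: x + (1 - t) *: y)).
Proof.
split=> [cV x y t t0 t1 Vx Vy|cV x y t /set_mem Vx /set_mem Vy].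
  have := cV x y (Itv01 t0 t1) (mem_set Vx) (mem_set Vy).
  by move=> /set_mem.
by apply/mem_set; apply: cV.
Qed.

Lemma sub_conv_hull (R : realType) (Y : lmodType R) (S : set Y) :
  S `<=` conv_hull S.
Proof. by move=> x Sx V [_ SV]; exact: SV. Qed.

Lemma convex_conv_hull (R : realType) (Y : lmodType R) (S : set Y) :
  @convex_set R Y (conv_hull S).
Proof.
apply/convex_setE => x y t t0 t1 Sx Sy V [cV SV].
by apply: (convex_setE V).1 => //; [exact: Sx|exact: Sy].
Qed.

(** The affine map [z |-> t^-1 (z - (1 - t) w)] sends the combination to [u], and any [z] that it
    sends into [U] is itself a convex combination of points of [U]. *)
Lemma interior_convex (R : realType) (Y : topologicalLmodType R) (U : set Y)
  (cU : @convex_set R Y U) (u w : Y) (t : R) : 0 < t -> t <= 1 ->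
  interior U u -> U w -> interior U (t *: u + (1 - t) *: w).
Proof.
move=> t0 t1 Uu Uw; set v := t *: u + _.
have eu : t^-1 *: v + (- (t^-1 * (1 - t)) *: w) = u.
  by rewrite scalerDr !scalerA mulVf ?gt_eqF// scale1r scaleNr addrK.
have := @nbhs_affine R Y t^-1 (- (t^-1 * (1 - t)) *: w) v U.
rewrite eu => /(_ Uu); rewrite /interior/=; apply: filterS => z /= Uz.
have -> : z = t *: (t^-1 *: z + - (t^-1 * (1 - t)) *: w) + (1 - t) *: w.
  rewrite scalerDr !scalerA mulrN mulrA divff ?gt_eqF// mul1r scale1r scaleNr.
  by rewrite addrNK.
by apply: (convex_setE U).1 => //; exact: ltW.
Qed.

(** Positivity on the cone [D] generated by [V - int U] is the separation. The normalization at
    [v0 - u0] keeps [g] nonzero. *)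
Lemma convex_separation (R : realType) (Y : topologicalLmodType R)
  (U V : set Y) (cU : @convex_set R Y U) (cV : @convex_set R Y V)
  (u0 v0 : Y) (Uu0 : interior U u0) (Vv0 : V v0)
  (UV0 : V `&` interior U = set0) :
  exists2 g : {linear Y -> R^o},
    (forall u v, interior U u -> V v -> (g u : R) <= g v) & g (v0 - u0) = 1.
Proof.
pose D := [set z | exists (t : R) v u,
  [/\ 0 <= t, V v, interior U u & z = t *: (v - u)]].
have cI u u' (t : R) : 0 <= t -> t <= 1 -> interior U u -> interior U u' ->
    interior U (t *: u + (1 - t) *: u').
  rewrite le_eqVlt => /predU1P[<- _ _|t0 t1 Iu Iu'].
    by rewrite scale0r add0r subr0 scale1r.
  by apply: interior_convex => //; exact: interior_subset.
have DD x y : D x -> D y -> D (x + y).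
  move=> [t [v [u [t0 Vv Uu ->]]]] [t' [v' [u' [t'0 Vv' Uu' ->]]]].
  have [tt0|tt0] := eqVneq (t + t') 0.
    have /andP[/eqP -> /eqP ->] : (t == 0) && (t' == 0).
      by rewrite -paddr_eq0// tt0.
    by exists 0, v, u; split => //; rewrite !scale0r addr0.
  have tt_gt0 : 0 < t + t' by rewrite lt_neqAle eq_sym tt0 addr_ge0.
  (* The same weights serve for both the [V] and the [U] components, so the sum is again a multiple
     of one difference. *)
  pose s := t / (t + t').
  have s0 : 0 <= s by rewrite divr_ge0// ltW.
  have s1 : s <= 1 by rewrite ler_pdivrMr// mul1r lerDl.
  exists (t + t'), (s *: v + (1 - s) *: v'), (s *: u + (1 - s) *: u').
  split; [exact: ltW|exact: (convex_setE V).1|exact: cI|].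
  rewrite opprD addrACA -!scalerBr [RHS]scalerDr !scalerA.
  congr (_ *: _ + _ *: _); rewrite /s; by field.
have DZ (t : R) x : 0 <= t -> D x -> D (t *: x).
  move=> t0 [s [v [u [s0 Vv Uu ->]]]]; exists (t * s), v, u.
  by split => //; [exact: mulr_ge0|rewrite scalerA].
have DB v u : V v -> interior U u -> D (v - u).
  by move=> Vv Uu; exists 1, v, u; split => //; rewrite scale1r.
have Dd : D (v0 - u0) by exact: DB.
have dunit y : exists2 e : R, 0 < e & D ((v0 - u0) + e *: y).
  have [e e0 Ue] : exists2 e : R, 0 < e & interior U (u0 + e *: - y).
    by apply: nbhs_ray; exact: nbhs_interior.
  exists e => //; have := DB _ _ Vv0 Ue.
  by rewrite scalerN opprD opprK addrA.
have dN : ~ D (- (v0 - u0)).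
  move=> [t [v [u [t0 Vv Uu E]]]].
  have t1_gt0 : 0 < t + 1 by lra.
  (* [s] solves [s = (1 - s) t], which makes the two convex combinations equal: a common point of
     [V] and [int U]. *)
  pose s := t / (t + 1).
  have s0 : 0 <= s by rewrite divr_ge0// ltW.
  have s1 : s <= 1 by rewrite ler_pdivrMr// mul1r; lra.
  have Es : s *: v + (1 - s) *: v0 = s *: u + (1 - s) *: u0.
    apply/eqP; rewrite -subr_eq0 opprD addrACA -!scalerBr.
    have -> : v0 - u0 = - (t *: (v - u)) by rewrite -E opprK.
    rewrite scalerN scalerA -scalerBl.
    have -> : s - (1 - s) * t = 0 by rewrite /s; field; rewrite gt_eqF.
    by rewrite scale0r.
  suff : set0 (s *: v + (1 - s) *: v0) by [].
  by rewrite -UV0; split; [exact: (convex_setE V).1|rewrite Es; exact: cI].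
have [g gD g1] := order_unit_functional DD DZ Dd dunit dN.
exists g => // u v Uu Vv; have := gD _ (DB _ _ Vv Uu).
by rewrite linearB subr_ge0.
Qed.

Lemma linear_continuous_bounded (R : realType) (Y : topologicalLmodType R)
  (g : {linear Y -> R^o}) (u : Y) (b : R) :
  nbhs u [set y | (g y : R) <= b] -> continuous (g : Y -> R^o).
Proof.
move=> nu x; apply/cvgrPdist_le => e e0.
have b0 : (g u : R) <= b by exact: nbhs_singleton nu.
(* The summand 1 keeps [M] positive even when [b = g u]. *)
pose M := b - g u + 1.
have M0 : 0 < M by rewrite /M; lra.
have hM : b - g u <= M by rewrite /M; lra.
have aux (w : R) : M / e * w <= M -> w <= e.
  rewrite -ler_pdivlMl ?divr_gt0// invf_div => /le_trans; apply.
  by rewrite divfK ?gt_eqF.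
(* The map [y |-> (M / e) s (y - x) + u] carries [x] to [u], so the one-sided bound near [u] becomes
   a bound near [x]; [s = 1] and [s = -1] give both sides. *)
have half (s : R) : nbhs x [set y | s * (g y - g x : R) <= e].
  have := @nbhs_affine R Y (M / e * s) (u - (M / e * s) *: x) x
    [set y | (g y : R) <= b].
  rewrite addrCA subrr addr0 => /(_ nu); apply: filterS => y /=.
  rewrite linearD linearB !linearZ/= => h.
  have : M / e * (s * (g y - g x)) <= M.
    apply: le_trans hM; rewrite mulrA mulrBr lerBrDr.
    by rewrite -mulrN -addrA [_ * - _ + _]addrC; exact: h.
  exact: aux.
have h1 := half 1; have h2 := half (-1).
near=> y.
have h3 : 1 * (g y - g x : R) <= e by near: y.
have h4 : -1 * (g y - g x : R) <= e by near: y.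
by rewrite ler_norml; apply/andP; split; lra.
Unshelve. all: by end_near. Qed.

Lemma seminorm0N (R : realType) (Y : lmodType R) (psi : Y -> R)
  (hpsi : is_seminorm psi) :
  psi 0 = 0 /\ forall y, psi (- y) = psi y.
Proof.
have [_ psiZ] := hpsi.
split=> [|y]; first by rewrite -(scale0r 0) psiZ normr0 mul0r.
by rewrite -scaleN1r psiZ normrN1 mul1r.
Qed.

(* The same identities with the codomain read as [R] instead of [R^o]. *)
Lemma linear_realE (R : realType) (Y : lmodType R) (g : {linear Y -> R^o}) :
  [/\ forall x y, g (x + y) = g x + g y :> R,
      forall (t : R) y, g (t *: y) = t * g y :> R &
      forall y, g (- y) = - g y :> R].
Proof. by split=> *; rewrite ?linearD ?linearZ ?linearN. Qed.

(** * Bishop-Phelps cones and their interiors *)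

Section BishopPhelps.
Context {R : realType} {Y : topologicalLmodType R} {psi : Y -> R}.
Hypothesis hpsi : is_seminorm psi.
Context {xs : {linear Y -> R^o}} {alpha : R}.
Hypothesis alpha0 : 0 <= alpha.
Local Notation C := (BP_cone psi xs alpha).

Lemma BP_coneD (x y : Y) : C x -> C y -> C (x + y).
Proof.
move=> Cx Cy; rewrite /BP_cone/= linearD; apply: le_trans (lerD Cx Cy).
by rewrite -mulrDr ler_wpM2l//; exact: hpsi.1.
Qed.

Lemma BP_coneZ (t : R) (y : Y) : 0 <= t -> C y -> C (t *: y).
Proof.
move=> t0 Cy; rewrite /BP_cone/= hpsi.2 linearZ/= ger0_norm// mulrCA.
by rewrite ler_wpM2l.
Qed.

Lemma interior_BP_coneD (x y : Y) : C x -> interior C y -> interior C (x + y).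
Proof.
move=> Cx Cy; have := @nbhs_affine R Y 1 (- x) (x + y) C.
rewrite scale1r addrAC subrr add0r => /(_ Cy); rewrite /interior/=.
apply: filterS => z /= Cz; rewrite -(subrKC x z); apply: BP_coneD => //.
by rewrite scale1r in Cz.
Qed.

Lemma interior_BP_coneZ (t : R) (y : Y) : 0 < t -> interior C y ->
  interior C (t *: y).
Proof.
move=> t0 Cy; have := @nbhs_affine R Y t^-1 0 (t *: y) C.
rewrite addr0 scalerA mulVf ?gt_eqF// scale1r => /(_ Cy); rewrite /interior/=.
apply: filterS => z /=; rewrite addr0 => Cz.
rewrite -[z]scale1r -(@divff _ t) ?gt_eqF// -scalerA.
by apply: BP_coneZ => //; exact: ltW.
Qed.

(* [xs - alpha * psi] is superlinear, so that a zero of it interior to [C]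
   would be a global maximum. *)
Lemma interior_BP_cone_gt : BP_cone_gt psi xs alpha !=set0 ->
  interior C `<=` BP_cone_gt psi xs alpha.
Proof.
move=> [y gty] c Cc; have [_ pN] := seminorm0N hpsi.
have [e e0] := nbhs_ray (- y) Cc; rewrite /BP_cone /BP_cone_gt/= => Ce.
have : alpha * psi c <= alpha * psi (c + e *: - y) + e * (alpha * psi y).
  rewrite mulrCA -mulrDr ler_wpM2l//.
  have := hpsi.1 (c + e *: - y) (e *: y).
  by rewrite scalerN subrK [psi (e *: y)]hpsi.2 gtr0_norm.
have [xsD xsZ xsN] := linear_realE xs.
move: Ce; rewrite xsD xsZ xsN mulrN => Ce cle.
have : e * (alpha * psi y) < e * xs y by rewrite ltr_pM2l.
lra.
Qed.

(** A strict inequality at [y] leaves room to subtract a small positive multiple of an interior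
    point [c] and stay in [C]; adding it back lands in the interior. *)
Lemma BP_cone_gt_interior : interior C !=set0 ->
  BP_cone_gt psi xs alpha `<=` interior C.
Proof.
move=> [c Cc] y gty; have [_ pN] := seminorm0N hpsi.
have [xsD xsZ xsN] := linear_realE xs.
(* Subtracting [e c] lowers [xs - alpha psi] by at most [e m]. If [m <= 0] then [e = 1] works;
   otherwise [e] is chosen so that [e m] uses up exactly the slack at [y]. *)
pose m := xs c + alpha * psi c.
have [m0|m0] := lerP m 0.
  have Cym : C (y - c).
    have := hpsi.1 y (- c); rewrite pN => /(ler_wpM2l alpha0) h.
    rewrite /BP_cone/= xsD xsN; apply: le_trans h _; rewrite mulrDr.
    by move: gty m0; rewrite /BP_cone_gt/= /m; lra.
  by rewrite -(subrK c y); exact: interior_BP_coneD.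
pose e := (xs y - alpha * psi y) / m.
have e0 : 0 < e by rewrite divr_gt0// subr_gt0.
rewrite -(subrK (e *: c) y); apply: interior_BP_coneD; last first.
  exact: interior_BP_coneZ.
rewrite /BP_cone/= xsD xsN xsZ.
have := hpsi.1 y (- (e *: c)); rewrite pN [psi (e *: c)]hpsi.2.
move=> /(ler_wpM2l alpha0) h; apply: le_trans h _.
have em : e * m = xs y - alpha * psi y by rewrite divfK ?gt_eqF.
rewrite gtr0_norm// mulrDr mulrCA.
by move: em; rewrite /m mulrDr; lra.
Qed.

End BishopPhelps.

(** * From separation to the augmented dual cone *)

(** A nonzero [y] divided by [psi y] lies in the base. No sign is imposed on [alpha]: the bound is
    used for [K] with [alpha] and for [A] with [- alpha]. *)
Lemma normlike_base_le (R : realType) (Y : lmodType R) (psi : Y -> R)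
  (hpsi : is_seminorm psi) (M : set Y) (Mbase : normlike_base psi M)
  (MZ : forall (t : R) y, 0 <= t -> M y -> M (t *: y))
  (g : {linear Y -> R^o}) (alpha : R)
  (gM : forall y, psi_base psi M y -> alpha <= g y) (y : Y) :
  M y -> alpha * psi y <= g y.
Proof.
have [p0 _] := seminorm0N hpsi; have [_ gZ _] := linear_realE g.
move=> My; have [->|/eqP y0] := eqVneq y 0; first by rewrite p0 linear0 mulr0.
have psi0 := Mbase _ My y0.
have : alpha <= g ((psi y)^-1 *: y).
  apply: gM; split; first by apply: MZ => //; rewrite invr_ge0 ltW.
  by rewrite hpsi.2 gtr0_norm ?invr_gt0// mulVf ?gt_eqF.
by rewrite gZ mulrC ler_pdivlMr.
Qed.

Lemma augmented_separation (R : realType) (Y : topologicalLmodType R)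
  (psi : Y -> R) (hpsi : is_seminorm psi) (K A : set Y)
  (KZ : forall (t : R) y, 0 <= t -> K y -> K (t *: y))
  (AZ : forall (t : R) y, 0 <= t -> A y -> A (t *: y))
  (hKbase : normlike_base psi K) (hAbase : normlike_base psi A)
  (hSsolid : solid (psi_conv psi (set_opp K)))
  (hsep : psi_conv0 psi A `&` interior (psi_conv psi (set_opp K)) = set0) :
  exists (xs : {linear Y -> R^o}) (alpha : R),
    [/\ aug_dual_int psi K (xs, alpha), BP_cone_gt psi xs alpha !=set0 &
        forall a, A a -> 0 <= xs a + alpha * psi a].
Proof.
have [_ pN] := seminorm0N hpsi.
set U := psi_conv psi (set_opp K) in hSsolid hsep *.
have [u0 Uu0] : interior U !=set0 := hSsolid.
(* Taking 0 as the base point of [V] turns the normalization into [g u0 = -1]. *)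
have V0 : psi_conv0 psi A 0 by apply: sub_conv_hull; left.
have cU : @convex_set R Y U by exact: convex_conv_hull.
have [g gUV] := convex_separation cU (@convex_conv_hull R Y _) Uu0 V0 hsep.
have [gD gZ gN] := linear_realE g.
rewrite sub0r gN => gu0.
have gU0 u : interior U u -> (g u : R) <= 0.
  by move=> Uu; have := gUV _ _ Uu V0; rewrite linear0.
pose E := [set (g u : R) | u in interior U].
have supE : has_sup E.
  split; first by exists (g u0), u0.
  by exists 0 => _ [u Uu <-]; exact: gU0.
pose alpha := - sup E.
have alpha0 : 0 <= alpha.
  rewrite oppr_ge0; apply: ge_sup; first by case: supE.
  by move=> _ [u Uu <-]; exact: gU0.
have gIU u : interior U u -> g u <= - alpha.
  by move=> Uu; rewrite opprK; apply: ub_le_sup; [case: supE|exists u].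
have gU u : U u -> g u <= - alpha.
  move=> Uu; rewrite leNgt; apply/negP => gt.
  have w0 : 0 < 1 + g u by have := gIU _ Uu0; lra.
  (* A short move from [u] towards [u0] enters [int U]. As [g u0 = -1], it costs [t (1 + g u)]; this
     [t] spends only half of the excess over [- alpha], contradicting [gIU]. *)
  pose t := (g u + alpha) / (1 + g u) / 2.
  have t0 : 0 < t by rewrite !divr_gt0//; lra.
  have tw : t * (1 + g u) = (g u + alpha) / 2.
    by rewrite /t; field; rewrite gt_eqF.
  have t1 : t <= 1.
    rewrite ler_pdivrMr// ler_pdivrMr// mulrDr.
    by have := gIU _ Uu0; lra.
  have := gIU _ (interior_convex cU t0 t1 Uu0 Uu).
  have -> : g (t *: u0 + (1 - t) *: u) = g u - t * (1 + g u).
    by rewrite gD !gZ (_ : g u0 = -1 :> R); [ring|lra].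
  by rewrite tw; lra.
have gA a : psi_base psi A a -> - alpha <= g a.
  move=> Aa; rewrite opprK; apply: ge_sup; first by case: supE.
  move=> _ [u Uu <-]; apply: gUV => //.
  by apply: sub_conv_hull; right.
have gK y : K y -> alpha * psi y <= g y.
  apply: (normlike_base_le hpsi hKbase KZ) => z [Kz pz].
  rewrite -lerN2 -gN; apply: gU; apply: sub_conv_hull.
  by split; [exists z|rewrite pN].
have gu0_lt : g u0 < - alpha.
  (* Moving from [u0] along [- u0] stays in [int U] and raises [g] by [e], so the bound [- alpha] is
     not attained at [u0]. *)
  have [e e0 Ue] := nbhs_ray (- u0) (nbhs_interior Uu0).
  have := gIU _ Ue; rewrite gD gZ gN gu0 mulr1 opprK; lra.
have gt0 : BP_cone_gt psi g alpha !=set0.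
  (* Otherwise [g >= - alpha] on the base of [-K], hence on its hull [U], against the strict bound
     at [u0]. *)
  apply: contrapT => /set0P/negP/negPn/eqP ngt.
  have : U `<=` [set y | - alpha <= g y].
    apply: smallest_sub.
      apply/convex_setE => x y t t0 t1 /= gx gy; rewrite gD !gZ.
      have -> : - alpha = t * - alpha + (1 - t) * - alpha by ring.
      by apply: lerD; rewrite ler_wpM2l// subr_ge0.
    move=> _ [[z Kz <-]] /=; rewrite pN gN lerN2 => pz; rewrite leNgt.
    apply/negP => gtz; have : BP_cone_gt psi g alpha z.
      by rewrite /BP_cone_gt/= pz mulr1.
    by rewrite ngt.
  by move=> /(_ u0 (interior_subset Uu0)) /=; rewrite leNgt gu0_lt.
exists g, alpha; split => //.
  split => //=.
    apply: (@linear_continuous_bounded R Y g u0 (- alpha)).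
    by move: Uu0; rewrite /interior/=; apply: filterS.
  move=> y Ky; rewrite subr_gt0.
  apply: (interior_BP_cone_gt hpsi alpha0 gt0).
  by move: y Ky; apply: interiorS.
move=> a Aa; rewrite -lerBlDr sub0r -mulNr.
exact: (normlike_base_le hpsi hAbase AZ).
Qed.

(** * Weak efficiency and scalarization *)

Theorem theorem29 (R : realType) (X Y : topologicalLmodType R)
  (Omega : set X) (hOmega : Omega !=set0) (f : X -> Y)
  (psi : Y -> R) (hpsi : is_seminorm psi)
  (K : set Y) (hK : is_cone K) (hKnt : nontrivial_set K) (hKsolid : solid K)
  (AA : X -> set Y)
  (hAA : (forall x, Omega x ->
            AA x = set_scale (nonneg_reals R)
                     (set_add (f @` Omega) [set - f x]))
      \/ (forall x, Omega x ->
            AA x = set_scale (nonneg_reals R)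
                     (set_add (set_add (f @` Omega) K) [set - f x])))
  (xbar : X) (hxbar : Omega xbar)
  (hAnt : nontrivial_set (AA xbar))
  (hKbase : normlike_base psi K) (hAbase : normlike_base psi (AA xbar))
  (hSsolid : solid (psi_conv psi (set_opp K)))
  (hsep : psi_conv0 psi (AA xbar) `&` interior (psi_conv psi (set_opp K))
          = set0) :
  exists (xs : {linear Y -> R^o}) (alpha : R),
    aug_dual_int psi K (xs, alpha) /\
    let C := BP_cone psi xs alpha in
    WEff Omega f C xbar /\
    (interior C !=set0 ->
     forall phi : Y -> R,
       is_sublinear phi -> phi 0 = 0 -> representing C phi ->
       [/\ (* (i) *)
           forall k, interior C k ->
             PS_solution Omega f phi (f xbar) k (xbar, 0),
           (* (ii) *)
           strictly_representing C phi ->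
             argmin_set Omega (fun x => phi (f x - f xbar)) xbar,
           (* the instance named in (ii) is strictly representing *)
           phi = BP_fun psi xs alpha -> BP_cone_gt psi xs alpha !=set0 ->
             strictly_representing C phi &
           forall (P T : set Y) (Rs : set R),
             T `<=` interior C ->
             f @` WEff Omega f C `<=` set_add P (set_scale Rs T) ->
             (* (iii) *)
             (exists a k s, [/\ P a, T k, Rs s &
                PS_solution Omega f phi a k (xbar, s)]) /\
             (* (iv) *)
             (closed C -> nontrivial_set C ->
              exists a k s, [/\ P a, T k, Rs s,
                s%:E = gerstewitz (set_add [set a] (set_opp C)) k (f xbar) &
                argmin_set Omega
                  (fun x => gerstewitz (set_add [set a] (set_opp C)) k (f x))
                  xbar])]).
Proof.
have [psi0 psiN] := seminorm0N hpsi.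
have scaleZ (S : set Y) (t : R) y : 0 <= t ->
    set_scale (nonneg_reals R) S y -> set_scale (nonneg_reals R) S (t *: y).
  move=> t0 [s s0 [z Sz <-]]; exists (t * s); first exact: mulr_ge0.
  by exists z => //; rewrite scalerA.
have KZ (t : R) y : 0 <= t -> K y -> K (t *: y).
  by move=> t0; rewrite hK.2; exact: scaleZ.
have AZ (t : R) y : 0 <= t -> AA xbar y -> AA xbar (t *: y).
  by case: hAA => ->//; exact: scaleZ.
have fS x (S : set Y) : S (f x) ->
    set_scale (nonneg_reals R) (set_add S [set - f xbar]) (f x - f xbar).
  move=> Sx; exists 1; first exact: ler01.
  exists (f x - f xbar); last by rewrite scale1r.
  by exists (f x) => //; exists (- f xbar).
have fA x : Omega x -> AA xbar (f x - f xbar).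
  move=> Ox; case: hAA => ->//; apply: fS; first by exists x.
  by exists (f x); [exists x|exists 0; [exact: hK.1|rewrite addr0]].
have [xs [alpha [xsK gt0 xsA]]] :=
  augmented_separation hpsi KZ AZ hKbase hAbase hSsolid hsep.
exists xs, alpha; split => //.
have alpha0 : 0 <= alpha by case: xsK.
have [_ _ xsN] := linear_realE xs.
move=> C.
have Cgt : interior C `<=` BP_cone_gt psi xs alpha.
  exact: interior_BP_cone_gt.
(* [xs + alpha psi] is nonnegative on [A], which contains [f x - f xbar], but negative at [- c]. *)
have IC c : interior C c -> forall x, Omega x -> f x - f xbar <> - c.
  move=> /Cgt gtc x Ox fx; have := xsA _ (fA _ Ox).
  by rewrite fx xsN psiN leNgt addrC subr_lt0 gtc.
have WE : WEff Omega f C xbar.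
  split=> // -[x Ox [c Cc fx]]; apply: (IC _ Cc _ Ox).
  by rewrite fx addrAC subrr add0r.
(* If [t < s], adding [(s - t) k], interior to [C], would put [- (f x - f xbar)] in [int C]. This
   gives minimality in (i) and (iii) and the lower bound in (iv). *)
have ray (x : X) (k : Y) (s t : R) : Omega x -> interior C k ->
    C (- (f x - f xbar + (s - t) *: k)) -> s <= t.
  move=> Ox Ck Cx; rewrite leNgt; apply/negP => ts.
  have stk : interior C ((s - t) *: k).
    by apply: interior_BP_coneZ => //; rewrite subr_gt0.
  apply: (IC _ (interior_BP_coneD hpsi alpha0 Cx stk) _ Ox).
  by rewrite opprD opprK addrK.
split => // Cne phi _ phi0 repr.
have reprP y : phi y <= 0 -> C (- y).
  move=> py; have : set_opp C y by rewrite repr.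
  by move=> [c Cc <-]; rewrite opprK.
(* When [f xbar = a + s k], replacing [a] by [f xbar] merely shifts the parameter by [s]. *)
have shift (x : X) (a k : Y) (s t : R) : a + s *: k = f xbar ->
    f x - a - t *: k = f x - f xbar + (s - t) *: k.
  by move=> <-; rewrite scalerBl opprD addrA addrA subrK.
have sol (a k : Y) (s : R) : interior C k -> a + s *: k = f xbar ->
    PS_solution Omega f phi a k (xbar, s).
  move=> Ck fxb; split=> /=.
    by split=> //=; rewrite (shift _ _ _ _ _ fxb) !subrr scale0r addr0 phi0.
  move=> [x t] [/= Ox]; rewrite (shift _ _ _ _ _ fxb) => /reprP.
  exact: ray.
split.
- by move=> k Ck; apply: sol => //; rewrite scale0r addr0.
- move=> [_ srepr]; split => // x Ox; rewrite subrr phi0 leNgt.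
  apply/negP => phix.
  have : set_opp (interior C) (f x - f xbar) by rewrite srepr.
  by move=> [c Cc fx]; exact: (IC _ Cc _ Ox).
- move=> phiE _; split => //; rewrite phiE.
  (* For [BP_fun], being negative at [y] means that [- y] is in the strict cone, which coincides
     with [int C]. *)
  apply/seteqP; split=> [_ [c /Cgt gtc <-]|y lty].
    by rewrite /BP_fun/= xsN psiN addrC subr_lt0.
  exists (- y); rewrite ?opprK//; apply: BP_cone_gt_interior => //.
  by move: lty; rewrite /BP_fun /BP_cone_gt/= xsN psiN addrC -ltrBrDr sub0r.
move=> P T Rs TC fWE.
have [a Pa [_ [s Rss [k Tk <-]] fxb]] : set_add P (set_scale Rs T) (f xbar).
  by apply: fWE; exists xbar.
have Ck := TC _ Tk.
split; first by exists a, k, s; split => //; exact: sol.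
move=> _ _; exists a, k, s.
have lower x : Omega x ->
    (s%:E <= gerstewitz (set_add [set a] (set_opp C)) k (f x))%E.
  move=> Ox; apply/ereal_infP => _ [t [_ -> [_ [_ -> [_ [c Cc <-] <-]] fx]] <-].
  rewrite lee_fin; apply: (ray x k) => //.
  rewrite -(shift _ _ _ _ _ fxb) -fx addrAC [t *: k + _]addrC addrK.
  by rewrite addrAC subrr add0r opprK.
(* Since 0 is in [C], the decomposition [f xbar = a + s k] makes [s] itself admissible in the
   infimum, so the lower bound is attained. *)
have C0 : C 0 by rewrite /C /BP_cone/= psi0 mulr0 linear0.
have upper : (gerstewitz (set_add [set a] (set_opp C)) k (f xbar) <= s%:E)%E.
  apply: ereal_inf_lbound; exists s => //; exists (s *: k) => //; exists a.
    by exists a => //; exists 0; rewrite ?addr0//; exists 0; rewrite ?oppr0.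
  by rewrite addrC.
have Gs : s%:E = gerstewitz (set_add [set a] (set_opp C)) k (f xbar).
  by apply/le_anti; rewrite upper lower.
by split => //; split => // x Ox; rewrite -Gs; exact: lower.
Qed.
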